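(* Let $0<s<d$. There exist constants $0<r<1$ and $C>0$, depending only on the dichotomy estimates, such that the following holds. For every $N\in\mathbb{N}$, $j\in\{1,\ldots,\varkappa\}$, and $\widetilde V\in\mathcal{G}(s,d)$ satisfying $$s=\sum_{i=j}^{\varkappa}d_i,\qquad \widetilde V\cap\bigoplus_{i=1}^{j-1}\mathcal{W}_N^i=\{0\},$$ define $\tilde\theta_{\min}=\theta_{\min}\big(\widetilde V,\bigoplus_{i=1}^{j-1}\mathcal{W}_N^i\big)$. Then $$\measuredangle\Big(\Phi(N-n,N)\widetilde V,\ \bigoplus_{i=j}^{\varkappa}\mathcal{W}_{N-n}^i\Big)\le\frac{C}{\tilde\theta_{\min}}\,r^n,\qquad 0\le n\le N,$$ $$\Big|\tilde\alpha_s^{\mathrm{disc}}(N-n,\widetilde V)-\tilde\alpha_s^{\mathrm{disc}}\Big(N-n,\bigoplus_{i=j}^{\varkappa}\mathcal{W}_N^i\Big)\Big|\le\frac{C}{n\,\tilde\theta_{\min}},\qquad 1\le n\le N,$$ where, for $V\in\mathcal{G}(s,d)$, $$\tilde\alpha_s^{\mathrm{disc}}(N-n,V):=\frac1n\sum_{k=1}^{n}\measuredangle\big(\Phi(N-k+1,N)V,\ \Phi(N-k,N)V\big).$$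
   Context: $\mathcal{G}(s,d)$ is the set of $s$-dimensional subspaces of $\mathbb{R}^d$; $\|\cdot\|$ is the Euclidean/spectral norm; $\mathcal{R}(P)$ and $\mathcal{N}(P)$ denote range and null space. Angles. For $V,W\in\mathcal{G}(s,d)$, $\measuredangle(V,W)\in[0,\frac{\pi}{2}]$ is the maximal principal angle: $\measuredangle(V,W)=\arccos(\sigma_s)$, where $\sigma_1\ge\dots\ge\sigma_s\ge0$ are the singular values of $V_B^\top W_B$ and the columns of $V_B,W_B\in\mathbb{R}^{d,s}$ are orthonormal bases of $V,W$. For nonzero subspaces $V,W$ (possibly of different dimension), the minimal principal angle is $\theta_{\min}(V,W)=\arccos\big(\max\{v^\top w: v\in V,\ w\in W,\ \|v\|=\|w\|=1\}\big)\in[0,\frac{\pi}{2}]$. Linear system. Consider $u_{n+1}=A_nu_n$, $n\in\mathbb{N}_0$, with invertible $A_n\in\mathbb{R}^{d,d}$ (in the paper $A_n=DF_n(x_n)$ is the variational equation along a fixed trajectory of $x_{n+1}=F_n(x_n)$ with $F_n\in C^1(\mathbb{R}^d,\mathbb{R}^d)$), such that $\sup_n\|A_n\|<\infty$ and $\sup_n\|A_n^{-1}\|<\infty$. The solution operator is $\Phi(n,m)=A_{n-1}\cdots A_m$ for $n>m$, $\Phi(n,n)=I_d$, $\Phi(n,m)=A_n^{-1}\cdots A_{m-1}^{-1}$ for $n<m$. Dichotomy data. By the spectral theorem for exponential dichotomies, there exist $\varkappa\le d$, numbers $$0=\sigma_{\varkappa+1}^+<\sigma_\varkappa^-\le\sigma_\varkappa^+<\sigma_{\varkappa-1}^-\le\sigma_{\varkappa-1}^+<\dots<\sigma_1^-\le\sigma_1^+$$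 and projectors $P_n^i\in\mathbb{R}^{d,d}$, $n\in\mathbb{N}_0$, $i=1,\dots,\varkappa+1$, which are fixed, with the following properties. (i) For all $0\le m\le n$ and all $i$: $\Phi(n,m)P_m^i=P_n^i\Phi(n,m)$; $\{0\}=\mathcal{R}(P_n^{\varkappa+1})\subseteq\mathcal{R}(P_n^{\varkappa})\subseteq\dots\subseteq\mathcal{R}(P_n^1)=\mathbb{R}^d$; $\mathbb{R}^d=\mathcal{N}(P_n^{\varkappa+1})\supseteq\mathcal{N}(P_n^\varkappa)\supseteq\dots\supseteq\mathcal{N}(P_n^1)=\{0\}$. (ii) (Dichotomy estimates.) For each $i=1,\dots,\varkappa$ and every $0<\varepsilon<\sigma_i^--\sigma_{i+1}^+$ there is a constant $K_i(\varepsilon)$ such that for all $0\le m\le n$: $\|\Phi(n,m)P_m^{i+1}\|\le K_i(\varepsilon)(\sigma_{i+1}^++\varepsilon)^{n-m}$ and $\|\Phi(m,n)(I_d-P_n^{i+1})\|\le K_i(\varepsilon)(\sigma_i^--\varepsilon)^{m-n}$. ''Depending only on the dichotomy estimates'' means depending only on the numbers $\varkappa,\sigma_i^{\pm}$ and the constants $K_i(\varepsilon)$, in particular not on $N$, $j$ or $\widetilde V$. Fibers: $\mathcal{W}_n^i=\mathcal{R}(P_n^i)\cap\mathcal{N}(P_n^{i+1})$, $i=1,\dots,\varkappa$, so that $\mathbb{R}^d=\bigoplus_{i=1}^{\varkappa}\mathcal{W}_n^i$; $d_i=\dim(\mathcal{W}_0^i)$ (which equals $\dim(\mathcal{W}_n^i)$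 for all $n$). *)

(* Defs.v *)
From HB Require Import structures.
From mathcomp Require Import all_boot all_order all_algebra.
From mathcomp Require Import boolp classical_sets reals trigo.

Set Implicit Arguments.
Unset Strict Implicit.
Unset Printing Implicit Defensive.

Import Order.TTheory GRing.Theory Num.Theory.

Local Open Scope ring_scope.

(* Vectors of R^d are columns 'cV[R]_d; subspaces are {vspace 'cV[R]_d}. *)

Definition dot (R : realType) (d : nat) (v w : 'cV[R]_d) : R :=
  (v^T *m w) ord0 ord0.

(* The norm that MathComp-Analysis puts on matrices is the maximum norm, so the
   Euclidean norm and the operator norm it induces are defined here. *)
Definition enorm (R : realType) (d : nat) (v : 'cV[R]_d) : R :=
  Num.sqrt (dot v v).

Definition opnorm (R : realType) (m n : nat) (A : 'M[R]_(m, n)) : R :=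
  sup [set x : R | exists2 v : 'cV[R]_n, enorm v <= 1 & x = enorm (A *m v)]%classic.

Definition mxhom (R : realType) (m n : nat) (A : 'M[R]_(m, n)) :
    'Hom('cV[R]_n, 'cV[R]_m) :=
  linfun (mulmx A : 'cV[R]_n -> 'cV[R]_m).

Definition mxrange (R : realType) (m n : nat) (A : 'M[R]_(m, n)) :
    {vspace 'cV[R]_m} := limg (mxhom A).

Definition mxnull (R : realType) (m n : nat) (A : 'M[R]_(m, n)) :
    {vspace 'cV[R]_n} := lker (mxhom A).

Definition mximage (R : realType) (m n : nat) (A : 'M[R]_(m, n))
    (V : {vspace 'cV[R]_n}) : {vspace 'cV[R]_m} := (mxhom A @: V)%VS.

Definition orthonormal_basis (R : realType) (d s : nat)
    (V : {vspace 'cV[R]_d}) (B : 'M[R]_(d, s)) : Prop :=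
  B^T *m B = 1%:M /\ mxrange B = V.

(* sv lists the singular values of M, with multiplicity, in decreasing order:
   the square roots of the eigenvalues of M^T M. *)
Definition singular_values (R : realType) (s : nat) (M : 'M[R]_s)
    (sv : seq R) : Prop :=
  [/\ sorted >=%R sv, all (fun x => 0 <= x) sv &
      char_poly (M^T *m M) = \prod_(x <- sv) ('X - (x ^+ 2)%:P)].

(* Maximal principal angle, for V and W of dimension s > 0. The set below is
   then a singleton: the angle does not depend on the orthonormal bases. As sv
   is 0-indexed, sv`_s.-1 is the smallest of the s singular values. *)
Definition max_angle (R : realType) (d s : nat) (V W : {vspace 'cV[R]_d}) : R :=
  xget 0 [set theta : R | exists (VB WB : 'M[R]_(d, s)) (sv : seq R),
    [/\ orthonormal_basis V VB, orthonormal_basis W WB,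
        singular_values (VB^T *m WB) sv & theta = acos sv`_s.-1]]%classic.

(* Minimal principal angle, for V and W nonzero; the supremum is then a maximum. *)
Definition min_angle (R : realType) (d : nat) (V W : {vspace 'cV[R]_d}) : R :=
  acos (sup [set c : R | exists v w : 'cV[R]_d,
    [/\ v \in V, w \in W, enorm v = 1, enorm w = 1 & c = dot v w]]%classic).

(* Phi(n, m) = A_(n-1) ... A_m if m <= n, and A_n^-1 ... A_(m-1)^-1 if n < m. *)
Definition solop (R : realType) (d : nat) (A : nat -> 'M[R]_d) (n m : nat) :
    'M[R]_d :=
  if (m <= n)%N then \big[mulmx/1%:M]_(k <- rev (index_iota m n)) A k
  else \big[mulmx/1%:M]_(n <= k < m) invmx (A k).

Definition bounded_system (R : realType) (d : nat) (A : nat -> 'M[R]_d) : Prop :=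
  [/\ forall n, A n \in unitmx,
      exists M : R, forall n, opnorm (A n) <= M &
      exists M : R, forall n, opnorm (invmx (A n)) <= M].

(* sm i and sp i are the endpoints sigma_i^- and sigma_i^+ of the i-th spectral
   interval; only the indices 1 <= i <= kappa, and i = kappa + 1 for sp, matter. *)
Definition spectral_data (R : realType) (kappa : nat) (sm sp : nat -> R) : Prop :=
  sp kappa.+1 = 0 /\
  forall i, (1 <= i <= kappa)%N -> sp i.+1 < sm i /\ sm i <= sp i.

(* P n i is the projector P_n^i, for 1 <= i <= kappa + 1. *)
Record dichotomy (R : realType) (d : nat) (A : nat -> 'M[R]_d) (kappa : nat)
    (sm sp : nat -> R) (K : nat -> R -> R) (P : nat -> nat -> 'M[R]_d) : Prop :=
  Dichotomy {
  dich_proj : forall n i, (1 <= i <= kappa.+1)%N -> P n i *m P n i = P n i;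
  dich_invariant : forall m n i, (m <= n)%N -> (1 <= i <= kappa.+1)%N ->
    solop A n m *m P m i = P n i *m solop A n m;
  dich_range_last : forall n, mxrange (P n kappa.+1) = 0%VS;
  dich_range_mono : forall n i, (1 <= i <= kappa)%N ->
    (mxrange (P n i.+1) <= mxrange (P n i))%VS;
  dich_range_first : forall n, mxrange (P n 1%N) = fullv;
  dich_null_last : forall n, mxnull (P n kappa.+1) = fullv;
  dich_null_mono : forall n i, (1 <= i <= kappa)%N ->
    (mxnull (P n i) <= mxnull (P n i.+1))%VS;
  dich_null_first : forall n, mxnull (P n 1%N) = 0%VS;
  dich_forward : forall i (e : R), (1 <= i <= kappa)%N ->
    0 < e -> e < sm i - sp i.+1 ->
    forall m n, (m <= n)%N ->
    opnorm (solop A n m *m P m i.+1) <= K i e * (sp i.+1 + e) ^+ (n - m);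
  dich_backward : forall i (e : R), (1 <= i <= kappa)%N ->
    0 < e -> e < sm i - sp i.+1 ->
    forall m n, (m <= n)%N ->
    opnorm (solop A m n *m (1%:M - P n i.+1)) <= K i e * (sm i - e) ^- (n - m)
  }.

Definition fiber (R : realType) (d : nat) (P : nat -> nat -> 'M[R]_d)
    (n i : nat) : {vspace 'cV[R]_d} :=
  (mxrange (P n i) :&: mxnull (P n i.+1))%VS.

(* The sum of the fibers W_n^i over a <= i < b; it is direct. *)
Definition fiber_sum (R : realType) (d : nat) (P : nat -> nat -> 'M[R]_d)
    (n a b : nat) : {vspace 'cV[R]_d} :=
  (\sum_(a <= i < b) fiber P n i)%VS.

(* alpha_disc A s N n V is the averaged angle written alpha_s(N - n, V), where
   V is a subspace at time N; it is used for 1 <= n <= N. *)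
Definition alpha_disc (R : realType) (d : nat) (A : nat -> 'M[R]_d)
    (s N n : nat) (V : {vspace 'cV[R]_d}) : R :=
  n%:R^-1 * \sum_(1 <= k < n.+1)
    max_angle s (mximage (solop A (N - k + 1) N) V)
                (mximage (solop A (N - k) N) V).

(* Main.v *)
From HB Require Import structures.
Require Import Defs.
From mathcomp Require Import all_boot all_order all_algebra.
From mathcomp Require Import boolp classical_sets reals trigo.
From mathcomp Require Import sesquilinear spectral complex.
From mathcomp Require Import topology normedtype derive.
From mathcomp Require Import ring lra.

Set Implicit Arguments.
Unset Strict Implicit.
Unset Printing Implicit Defensive.

Import Order.TTheory GRing.Theory Num.Theory.
Import numFieldNormedType.Exports.

Local Open Scope ring_scope.

(** Split a vector v of V as x + u along R(P) and N(P), where P = P_N^j, so that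
    R(P) is the sum of the slow fibers (those with index at least j) and N(P)
    the sum of the fast ones. As V meets N(P) only in 0, the minimal angle theta
    between them is positive; since |x| = |v - u| is at least the distance of u
    to V, it is at least |u| sin theta, so that |u| <= (2 / theta) |x|.
    Backwards in time over n steps the dichotomy estimates let x shrink at most
    by a factor 1 / (K (sp j + e)^n) and expand u at most by
    K (sm (j-1) - e)^-n. The images of v and x therefore differ, relative to the
    image of x, by at most (2 K^2 / theta) q^n with
    q = (sp j + e) / (sm (j-1) - e) < 1. Because V and R(P) have equal
    dimension, P maps V onto R(P), so every vector of one image subspace has
    such a companion in the other ([transversal_image_close],
    [dichotomy_convergence]). There are only finitely many gaps, whence uniform
    constants ([spectral_gap_constants]).

    To turn closeness of vectors into a bound on the maximal principal angle,
    the smallest singular value of V_B^T W_B is identified with the minimum over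
    w in W of the maximum over v in V of the cosine between v and w
    ([max_angle_minmax]). This rests on the spectral theorem for real symmetric
    matrices, obtained by passing to the complex numbers
    ([symmetric_spectrum]), and on Gram-Schmidt. It also reduces the triangle
    inequality for the maximal principal angle to that for angles between
    vectors ([max_angle_triangle]).

    The second estimate follows from the first: by the triangle inequality each
    of the n angles being averaged changes by O(r^(k-1) / theta), and the sum of
    these errors stays bounded as n grows ([alpha_disc_dist_le]). Since the
    triangle inequality is used at both ends of a chain, closeness is needed for
    the pair of subspaces in both orders. *)

(** * Euclidean geometry of column vectors *)

Lemma dotE (R : realType) d (v w : 'cV[R]_d) :
  dot v w = \sum_i v i 0 * w i 0.
Proof. by rewrite /dot !mxE; apply: eq_bigr => i _; rewrite mxE. Qed.

Lemma dotC (R : realType) d (v w : 'cV[R]_d) : dot v w = dot w v.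
Proof. by rewrite !dotE; apply: eq_bigr => i _; rewrite mulrC. Qed.

Lemma dotDl (R : realType) d (u v w : 'cV[R]_d) :
  dot (u + v) w = dot u w + dot v w.
Proof. by rewrite /dot linearD /= mulmxDl mxE. Qed.

Lemma dotZl (R : realType) d a (v w : 'cV[R]_d) : dot (a *: v) w = a * dot v w.
Proof. by rewrite /dot linearZ /= -scalemxAl mxE. Qed.

Lemma dotNl (R : realType) d (v w : 'cV[R]_d) : dot (- v) w = - dot v w.
Proof. by rewrite -scaleN1r dotZl mulN1r. Qed.

Lemma dotBl (R : realType) d (u v w : 'cV[R]_d) :
  dot (u - v) w = dot u w - dot v w.
Proof. by rewrite dotDl dotNl. Qed.

Lemma dotDr (R : realType) d (u v w : 'cV[R]_d) :
  dot w (u + v) = dot w u + dot w v.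
Proof. by rewrite !(dotC w) dotDl. Qed.

Lemma dotZr (R : realType) d a (v w : 'cV[R]_d) : dot v (a *: w) = a * dot v w.
Proof. by rewrite !(dotC v) dotZl. Qed.

Lemma dot0r (R : realType) d (v : 'cV[R]_d) : dot v 0 = 0.
Proof. by rewrite -(scale0r (0 : 'cV[R]_d)) dotZr mul0r. Qed.

Lemma dotBr (R : realType) d (u v w : 'cV[R]_d) :
  dot w (u - v) = dot w u - dot w v.
Proof. by rewrite !(dotC w) dotBl. Qed.

Lemma dot_ge0 (R : realType) d (v : 'cV[R]_d) : 0 <= dot v v.
Proof. by rewrite dotE sumr_ge0 // => i _; rewrite -expr2 sqr_ge0. Qed.

Lemma dot_eq0 (R : realType) d (v : 'cV[R]_d) : (dot v v == 0) = (v == 0).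
Proof.
apply/idP/eqP => [|->]; last by rewrite dotE big1 // => i _; rewrite mxE mul0r.
rewrite dotE psumr_eq0 => [/allP v0|i _]; last by rewrite -expr2 sqr_ge0.
apply/matrixP => i j; rewrite ord1 mxE; apply/eqP.
by have := v0 i (mem_index_enum i); rewrite mulf_eq0 orbb.
Qed.

Lemma dot_mulmxl (R : realType) m n (A : 'M[R]_(m, n)) x y :
  dot (A *m x) y = dot x (A^T *m y).
Proof. by rewrite /dot trmx_mul mulmxA. Qed.

Lemma enorm_ge0 (R : realType) d (v : 'cV[R]_d) : 0 <= enorm v.
Proof. exact: sqrtr_ge0. Qed.

Lemma enorm_sqr (R : realType) d (v : 'cV[R]_d) : enorm v ^+ 2 = dot v v.
Proof. by rewrite sqr_sqrtr ?dot_ge0. Qed.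

Lemma enorm_eq0 (R : realType) d (v : 'cV[R]_d) : (enorm v == 0) = (v == 0).
Proof. by rewrite -dot_eq0 -enorm_sqr sqrf_eq0. Qed.

Lemma enorm0 (R : realType) d : enorm (0 : 'cV[R]_d) = 0.
Proof. by apply/eqP; rewrite enorm_eq0. Qed.

Lemma enorm_gt0 (R : realType) d (v : 'cV[R]_d) : (0 < enorm v) = (v != 0).
Proof. by rewrite lt_def enorm_eq0 enorm_ge0 andbT. Qed.

Lemma enormZ (R : realType) d a (v : 'cV[R]_d) :
  enorm (a *: v) = `|a| * enorm v.
Proof.
by rewrite /enorm dotZl dotZr mulrA -expr2 sqrtrM ?sqr_ge0 // sqrtr_sqr.
Qed.

Lemma enorm_normalize (R : realType) d (v : 'cV[R]_d) :
  v != 0 -> enorm ((enorm v)^-1 *: v) = 1.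
Proof.
move=> v0; rewrite enormZ ger0_norm ?invr_ge0 ?enorm_ge0 // mulVf //.
by rewrite enorm_eq0.
Qed.

Lemma enorm1_neq0 (R : realType) d (v : 'cV[R]_d) : enorm v = 1 -> v != 0.
Proof. by rewrite -enorm_eq0 => ->; rewrite oner_eq0. Qed.

Lemma dot_le_enorm (R : realType) d (v w : 'cV[R]_d) :
  dot v w <= enorm v * enorm w.
Proof.
have [->|w0] := eqVneq w 0; first by rewrite enorm0 mulr0 dot0r.
apply: (le_trans (ler_norm _)).
rewrite -ler_sqr ?nnegrE ?mulr_ge0 ?enorm_ge0 ?normr_ge0 //.
rewrite exprMn !enorm_sqr real_normK ?num_real //.
have w2 : 0 < dot w w by rewrite lt_def dot_eq0 w0 dot_ge0.
have := dot_ge0 (dot w w *: v - dot v w *: w).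
rewrite !(dotBl, dotBr, dotZl, dotZr) (dotC w v) => h.
have : 0 <= dot w w * (dot v v * dot w w - dot v w ^+ 2) by nra.
by rewrite pmulr_rge0 // subr_ge0.
Qed.

Lemma enormN (R : realType) d (v : 'cV[R]_d) : enorm (- v) = enorm v.
Proof. by rewrite -scaleN1r enormZ normrN1 mul1r. Qed.

Lemma enorm_distC (R : realType) d (v w : 'cV[R]_d) :
  enorm (v - w) = enorm (w - v).
Proof. by rewrite -enormN opprB. Qed.

Lemma dot1_itv (R : realType) d (v w : 'cV[R]_d) :
  enorm v = 1 -> enorm w = 1 -> -1 <= dot v w <= 1.
Proof.
move=> v1 w1; have := dot_le_enorm v w; have := dot_le_enorm (- v) w.
by rewrite enormN dotNl v1 w1 mulr1; lra.
Qed.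

Lemma mulmx_enorm_bounded (R : realType) m n (A : 'M[R]_(m, n)) :
  exists2 M, 0 <= M & forall v, enorm (A *m v) <= M * enorm v.
Proof.
exists (Num.sqrt (\sum_i dot (row i A)^T (row i A)^T)); first exact: sqrtr_ge0.
move=> v; rewrite -ler_sqr ?nnegrE ?mulr_ge0 ?sqrtr_ge0 ?enorm_ge0 //.
have ge0 : 0 <= \sum_i dot (row i A)^T (row i A)^T.
  by apply: sumr_ge0 => i _; exact: dot_ge0.
rewrite exprMn (sqr_sqrtr ge0) !enorm_sqr mulr_suml dotE; apply: ler_sum => i _.
have -> : (A *m v) i 0 = dot (row i A)^T v.
  by rewrite dotE mxE; apply: eq_bigr => k _; rewrite !mxE.
rewrite -expr2 -!enorm_sqr -exprMn -real_normK ?num_real //.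
rewrite ler_sqr ?nnegrE ?mulr_ge0 ?enorm_ge0 ?normr_ge0 //.
rewrite ler_norml dot_le_enorm andbT.
have := dot_le_enorm (- (row i A)^T) v.
by rewrite enormN dotNl; lra.
Qed.

Lemma enorm_mulmx_le (R : realType) m n (A : 'M[R]_(m, n)) v :
  enorm (A *m v) <= opnorm A * enorm v.
Proof.
have [->|v0] := eqVneq v 0; first by rewrite mulmx0 !enorm0 mulr0.
have v_gt0 : 0 < enorm v by rewrite enorm_gt0.
rewrite -ler_pdivrMr // mulrC.
have -> : (enorm v)^-1 * enorm (A *m v) = enorm (A *m ((enorm v)^-1 *: v)).
  by rewrite -scalemxAr enormZ ger0_norm // invr_ge0 enorm_ge0.
apply: ub_le_sup; last by exists ((enorm v)^-1 *: v); rewrite ?enorm_normalize.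
have [M M0 hM] := mulmx_enorm_bounded A.
exists M => _ [w w1 ->]; apply: (le_trans (hM w)).
by rewrite -[leRHS]mulr1 ler_wpM2l.
Qed.

Lemma opnorm_ge0 (R : realType) m n (A : 'M[R]_(m, n)) : 0 <= opnorm A.
Proof.
have [M M0 hM] := mulmx_enorm_bounded A.
rewrite /opnorm; apply: ub_le_sup; last by exists 0; rewrite ?mulmx0 ?enorm0.
exists M => _ [w w1 ->]; apply: (le_trans (hM w)).
by rewrite -[leRHS]mulr1 ler_wpM2l.
Qed.

(** * Angles between vectors *)

(** Halving the angle keeps the derivative of the sine away from zero. By the
    mean value theorem sin (t/2) >= (t/2) cos (t/2), so that
    sin t = 2 sin (t/2) cos (t/2) >= t cos^2 (t/2), and
    2 cos^2 (t/2) = 1 + cos t >= 1. *)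
Lemma half_le_sin (R : realType) (t : R) : 0 <= t <= pi / 2 -> t / 2 <= sin t.
Proof.
move=> /andP[t0 tpi]; set u := t / 2.
have tE : t = u *+ 2 by rewrite /u -mulr_natr mulfVK // pnatr_eq0.
have u0 : 0 <= u by rewrite /u divr_ge0.
have pi0 : 0 < pi :> R := pi_gt0 R.
have ut : u <= t by rewrite tE mulr2n lerDr.
have upi : u <= pi / 2 := le_trans ut tpi.
have [|c cu] := @MVT_segment R sin cos 0 u u0 (fun x _ => is_derive_sin x).
  by apply: continuous_subspaceT => x; exact: continuous_sin.
rewrite sin0 !subr0 => sinu; move: cu; rewrite in_itv /= => /andP[c0 cu].
have coscu : cos u <= cos c.
  by rewrite leNgt ltr_cos ?in_itv /= -?leNgt //; apply/andP; split; lra.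
have cosu0 : 0 <= cos u by apply: cos_ge0_pihalf; apply/andP; split; lra.
have cost0 : 0 <= cos t by apply: cos_ge0_pihalf; apply/andP; split; lra.
have cosu2 : 1 <= cos u ^+ 2 *+ 2.
  by move: cost0; rewrite tE cos_mulr2n subr_ge0.
rewrite {1}tE sin_mulr2n sinu -mulr_natr.
have h : u * cos u ^+ 2 <= u * (cos c * cos u).
  by rewrite ler_wpM2l // expr2 ler_wpM2r.
have h' : u * 1 <= u * (cos u ^+ 2 *+ 2) by rewrite ler_wpM2l.
move: h'; rewrite -mulr_natr; lra.
Qed.

Lemma acos_le (R : realType) (a b : R) :
  -1 <= a -> a <= b -> b <= 1 -> acos b <= acos a.
Proof.
move=> a1 ab b1.
have ha : -1 <= a <= 1 by rewrite a1 (le_trans ab).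
have hb : -1 <= b <= 1 by rewrite b1 (le_trans a1).
rewrite leNgt -ltr_cos ?in_itv /= ?acos_ge0 ?acos_lepi //.
by rewrite !acosK ?in_itv // -leNgt.
Qed.

Lemma acos_le_pihalf (R : realType) (c : R) : 0 <= c <= 1 -> acos c <= pi / 2.
Proof. by move=> /andP[c0 c1]; rewrite -acos0 acos_le // lerN10. Qed.

Lemma pihalf_le2 (R : realType) : pi / 2 <= 2 :> R.
Proof. by have /andP[_ /ltW] := pihalf_02 R. Qed.

Lemma acos_le_sqrt (R : realType) (c : R) :
  0 <= c <= 1 -> acos c <= 2 * Num.sqrt (1 - c ^+ 2).
Proof.
move=> c01; have /andP[c0 c1] := c01.
have c11 : -1 <= c <= 1 by rewrite c1 (le_trans _ c0) // lerN10.
have := @half_le_sin R (acos c).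
rewrite acos_ge0 // acos_le_pihalf // sin_acos // => /(_ isT); lra.
Qed.

(** Decomposing u and w along v and its orthogonal complement, the components
    orthogonal to v have norms the sines of the two angles at v, so that by
    Cauchy-Schwarz u . w >= cos a cos b - sin a sin b = cos (a + b). *)
Lemma acos_dot_triangle (R : realType) d (u v w : 'cV[R]_d) :
  enorm u = 1 -> enorm v = 1 -> enorm w = 1 ->
  acos (dot u w) <= acos (dot u v) + acos (dot v w).
Proof.
move=> u1 v1 w1.
have huv := dot1_itv u1 v1; have hvw := dot1_itv v1 w1.
have huw := dot1_itv u1 w1.
have [pile|lepi] := leP pi (acos (dot u v) + acos (dot v w)).
  exact: le_trans (acos_lepi huw) pile.
rewrite -[leRHS]cosK; last first.
  by rewrite in_itv /= addr_ge0 ?acos_ge0 // ltW.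
apply: acos_le; rewrite ?cos_geN1 //; last by case/andP: huw.
rewrite cosD !acosK ?in_itv // !sin_acos //.
pose p := u - dot u v *: v; pose q := dot v w *: v - w.
have pp : dot p p = 1 - dot u v ^+ 2.
  rewrite /p !(dotBl, dotBr, dotZl, dotZr) (dotC v u) -!enorm_sqr u1 v1; ring.
have qq : dot q q = 1 - dot v w ^+ 2.
  rewrite /q !(dotBl, dotBr, dotZl, dotZr) (dotC w v) -!enorm_sqr v1 w1; ring.
have pq : dot p q = dot u v * dot v w - dot u w.
  rewrite /p /q !(dotBl, dotBr, dotZl, dotZr) -!enorm_sqr v1; ring.
have := dot_le_enorm p q.
by rewrite /enorm pp qq pq; lra.
Qed.

(** By the inequality of arithmetic and geometric means,
    2 v . w >= |w|^2 + (1 - rho^2) |v|^2 >= 2 sqrt (1 - rho^2) |v| |w|. *)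
Lemma acos_normalize_le (R : realType) d (v w : 'cV[R]_d) (rho : R) :
  v != 0 -> w != 0 -> rho < 1 -> enorm (v - w) <= rho * enorm v ->
  0 <= dot ((enorm v)^-1 *: v) ((enorm w)^-1 *: w) /\
  acos (dot ((enorm v)^-1 *: v) ((enorm w)^-1 *: w)) <= 2 * rho.
Proof.
move=> v0 w0 rho1 hvw.
have ev : 0 < enorm v by rewrite enorm_gt0.
have ew : 0 < enorm w by rewrite enorm_gt0.
have rho0 : 0 <= rho.
  by rewrite -(pmulr_lge0 _ ev); exact: le_trans (enorm_ge0 _) hvw.
set s := Num.sqrt (1 - rho ^+ 2).
have s2 : s ^+ 2 = 1 - rho ^+ 2 by rewrite sqr_sqrtr //; nra.
have s0 : 0 <= s by exact: sqrtr_ge0.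
have key : s * (enorm v * enorm w) <= dot v w.
  have : enorm (v - w) ^+ 2 <= (rho * enorm v) ^+ 2.
    by rewrite ler_sqr ?nnegrE ?mulr_ge0 ?enorm_ge0.
  rewrite enorm_sqr !(dotBl, dotBr) (dotC w v) -!enorm_sqr exprMn.
  have := sqr_ge0 (s * enorm v - enorm w); rewrite sqrrB exprMn s2 -mulr_natr.
  lra.
have sc : s <= dot ((enorm v)^-1 *: v) ((enorm w)^-1 *: w).
  by rewrite dotZl dotZr mulrA -invfM mulrC ler_pdivlMr // mulr_gt0.
have /andP[_ c1] := dot1_itv (enorm_normalize v0) (enorm_normalize w0).
set c := dot _ _ in sc c1 *; have c0 : 0 <= c := le_trans s0 sc.
split=> //; apply: (le_trans (acos_le_sqrt _)); first by rewrite c0.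
rewrite ler_pM2l ?ltr0n //.
rewrite -(ger0_norm rho0) -sqrtr_sqr ler_wsqrtr //.
have : s ^+ 2 <= c ^+ 2 by rewrite ler_sqr ?nnegrE.
by rewrite s2; lra.
Qed.

(** * Singular values *)

Lemma char_poly_conj (F : fieldType) n (P D : 'M[F]_n) :
  P \in unitmx -> char_poly (invmx P *m D *m P) = char_poly D.
Proof.
move=> Pu; rewrite /char_poly /char_poly_mx.
have PP : map_mx polyC (invmx P) *m map_mx polyC P = 1%:M.
  by rewrite -map_mxM mulVmx // map_mx1.
have -> : 'X%:M - map_mx polyC (invmx P *m D *m P) =
    map_mx polyC (invmx P) *m ('X%:M - map_mx polyC D) *m map_mx polyC P.
  by rewrite mulmxBr mulmxBl !map_mxM /= scalar_mxC -(mulmxA 'X%:M) PP mulmx1.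
by rewrite !det_mulmx mulrAC -det_mulmx PP det1 mul1r.
Qed.

(** A real symmetric matrix is Hermitian over R[i], hence unitarily
    diagonalizable there with a real diagonal; the Rayleigh quotient of a real
    vector is then a weighted mean of the diagonal entries. *)
Lemma symmetric_spectrum (R : realType) n (S : 'M[R]_n) : S^T = S ->
  exists2 l : 'I_n -> R, char_poly S = \prod_i ('X - (l i)%:P) &
  forall c x, (forall i, c <= l i) -> c * dot x x <= dot x (S *m x).
Proof.
move=> symS; pose f : {rmorphism R -> R[i]} := real_complex R.
have conjf a : Num.conj (f a) = f a.
  by apply: conj_Creal; apply/complex_realP; exists a.
pose Sc := map_mx f S.
have conj_map m p (A : 'M[R]_(m, p)) :
    map_mx Num.conj (map_mx f A) = map_mx f A.
  by apply/matrixP => i j; rewrite !mxE conjf.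
have hermS : Sc \is hermsymmx.
  by apply/is_hermitianmxP; rewrite expr0 scale1r /Sc map_trmx conj_map symS.
have /orthomx_spectralP := hermitian_normalmx hermS.
set P := spectralmx Sc; set D := spectral_diag Sc => ScE.
have Pu : P \is unitarymx := spectral_unitarymx Sc.
have Dreal i : D 0 i \is Num.real.
  by have /mxOverP := hermitian_spectral_diag_real hermS.
pose l i := complex.Re (D 0 i).
have fl i : f (l i) = D 0 i by apply: RRe_real; exact: Dreal.
exists l.
  apply: (@map_poly_inj _ _ f).
  rewrite map_char_poly -/Sc ScE char_poly_conj ?unitarymx_unit //.
  rewrite char_poly_trig ?diag_mx_is_trig // rmorph_prod /=.
  by apply: eq_bigr => i _; rewrite map_polyXsubC mxE eqxx mulr1n -fl.
move=> c x cl; suff : 0 <= f (dot x (S *m x) - c * dot x x).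
  by move=> h; rewrite -subr_ge0 -ler0c.
pose y := P *m map_mx f x.
have dotc (A : 'M[R]_n) : f (dot x (A *m x)) =
    ((map_mx f x)^T *m map_mx f A *m map_mx f x) 0 0.
  by rewrite /dot mulmxA map_trmx -!map_mxM [RHS]mxE.
have yt : (map_mx f x)^T *m invmx P = map_mx Num.conj y^T.
  rewrite invmx_unitary // /y trmx_mul map_mxM; congr (_ *m _).
  by rewrite map_trmx conj_map.
have sumD (E : 'rV[R[i]]_n) :
    (map_mx Num.conj y^T *m diag_mx E *m y) 0 0 = \sum_i E 0 i * `|y i 0| ^+ 2.
  rewrite mxE; apply: eq_bigr => i _.
  by rewrite mul_mx_diag !mxE normCK; ring.
have -> : f (dot x (S *m x) - c * dot x x) =
    \sum_i (D 0 i - f c) * `|y i 0| ^+ 2.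
  rewrite -dotZr -mul_scalar_mx rmorphB !dotc -/Sc ScE map_scalar_mx /=.
  rewrite !mulmxA yt -mulmxA -/y sumD.
  have -> : (map_mx f x)^T *m (f c)%:M *m map_mx f x =
      map_mx Num.conj y^T *m diag_mx (const_mx (f c)) *m y.
    rewrite diag_const_mx 2!mul_mx_scalar -2!scalemxAl -yt /y.
    by rewrite [X in _ = _ *: X]mulmxA mulmxKV ?unitarymx_unit.
  rewrite sumD -sumrB; apply: eq_bigr => i _.
  by rewrite -mulrBl [const_mx _ _ _]mxE.
apply: sumr_ge0 => i _; rewrite mulr_ge0 ?exprn_ge0 //.
by rewrite -fl subr_ge0 /= lecR.
Qed.

Lemma gram_sym (R : realType) m n (M : 'M[R]_(m, n)) :
  (M^T *m M)^T = M^T *m M.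
Proof. by rewrite trmx_mul trmxK. Qed.

Lemma dot_gram (R : realType) m n (M : 'M[R]_(m, n)) x :
  dot x (M^T *m M *m x) = enorm (M *m x) ^+ 2.
Proof. by rewrite enorm_sqr dot_mulmxl mulmxA. Qed.

Lemma gram_eigenvector (R : realType) m n (M : 'M[R]_(m, n)) l :
  root (char_poly (M^T *m M)) l ->
  exists2 x, enorm x = 1 & enorm (M *m x) ^+ 2 = l.
Proof.
rewrite -eigenvalue_root_char => /eigenvalueP[v vM v0].
have vT0 : v^T != 0 by rewrite -(inj_eq (@trmx_inj _ _ _)) trmxK trmx0.
exists ((enorm v^T)^-1 *: v^T); first exact: enorm_normalize.
have vE : M^T *m M *m v^T = l *: v^T.
  by rewrite -{1}gram_sym -trmx_mul vM linearZ.
rewrite -dot_gram -scalemxAr vE scalerA [_ * l]mulrC -scalerA dotZr -enorm_sqr.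
by rewrite enorm_normalize // expr1n mulr1.
Qed.

Lemma singular_values_exist (R : realType) s (M : 'M[R]_s) :
  exists sv, singular_values M sv.
Proof.
have [l lE _] := symmetric_spectrum (gram_sym M).
have l0 i : 0 <= l i.
  have : root (char_poly (M^T *m M)) (l i).
    by rewrite lE (bigD1 i) //= rootM root_XsubC eqxx.
  by case/gram_eigenvector => x _ <-; exact: sqr_ge0.
pose t := [seq Num.sqrt (l i) | i <- enum 'I_s].
exists (sort >=%R t); split.
- exact: (sort_sorted (@ge_total _ _)).
- by apply/allP => x; rewrite mem_sort => /mapP[i _ ->]; exact: sqrtr_ge0.
rewrite lE (perm_big t) ?perm_sort //= big_map big_enum /=.
by apply: eq_bigr => i _; rewrite sqr_sqrtr.
Qed.

Lemma size_singular_values (R : realType) s (M : 'M[R]_s) sv :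
  singular_values M sv -> size sv = s.
Proof.
case=> _ _ /(congr1 (fun p : {poly R} => size p)).
by rewrite size_char_poly size_prod_XsubC => -[].
Qed.

Lemma singular_values_last_ge0 (R : realType) s (M : 'M[R]_s) sv :
  singular_values M sv -> 0 <= sv`_s.-1.
Proof.
move=> svM; have sz := size_singular_values svM; case: svM => _ /allP ge0 _.
case: s M sz ge0 => [|s] M sz ge0 /=; last by rewrite ge0 // mem_nth // sz.
by rewrite nth_default // sz.
Qed.

(** The eigenvalues of M^T M are the squares of the listed values, so the
    smallest of them bounds the Rayleigh quotient |M x|^2 / |x|^2 below. *)
Lemma singular_value_last_le (R : realType) s (M : 'M[R]_s) sv x :
  singular_values M sv -> sv`_s.-1 * enorm x <= enorm (M *m x).
Proof.
move=> svM; have sz := size_singular_values svM.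
have ge0 := singular_values_last_ge0 svM; case: svM => srt /allP pos svE.
have [l lE lmin] := symmetric_spectrum (gram_sym M).
rewrite -ler_sqr ?nnegrE ?mulr_ge0 ?enorm_ge0 // exprMn -dot_gram enorm_sqr.
apply: lmin => i.
have : root (char_poly (M^T *m M)) (l i).
  by rewrite lE (bigD1 i) //= rootM root_XsubC eqxx.
rewrite svE -(big_map (fun x => x ^+ 2) predT (fun a => 'X - a%:P)).
rewrite root_prod_XsubC => /mapP[t tsv ->].
rewrite ler_sqr ?nnegrE // ?pos //.
have := tsv; rewrite -index_mem sz => ts.
rewrite -[leRHS](nth_index 0 tsv).
have s0 : (0 < s)%N by apply: leq_ltn_trans ts.
have geT : transitive (>=%R : rel R).
  by move=> a b c ab bc; exact: le_trans bc ab.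
have geR : reflexive (>=%R : rel R) by move=> a; exact: lexx.
apply: (sorted_leq_nth geT geR 0 srt); rewrite ?inE ?sz ?ltn_predL //.
by rewrite -ltnS prednK.
Qed.

Lemma singular_value_last_attained (R : realType) s (M : 'M[R]_s) sv :
  (0 < s)%N -> singular_values M sv ->
  exists2 x, enorm x = 1 & enorm (M *m x) = sv`_s.-1.
Proof.
move=> s0 svM; have ge0 := singular_values_last_ge0 svM.
have sz := size_singular_values svM; case: svM => _ _ svE.
have [|x x1 xE] := @gram_eigenvector _ _ _ M (sv`_s.-1 ^+ 2).
  rewrite svE -(big_map (fun x => x ^+ 2) predT (fun a => 'X - a%:P)).
  rewrite root_prod_XsubC; apply/mapP; exists sv`_s.-1 => //.
  by rewrite mem_nth // sz ltn_predL.
exists x => //; apply/eqP.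
by rewrite -(eqrXn2 (ltn0Sn 1)) ?enorm_ge0 // xE.
Qed.

(** * Ranges, kernels and orthonormal bases *)

Lemma mxhomE (R : realType) m n (A : 'M[R]_(m, n)) (x : 'cV[R]_n) :
  mxhom A x = A *m x.
Proof. by rewrite lfunE. Qed.

Lemma mem_mximageP (R : realType) m n (A : 'M[R]_(m, n)) (V : {vspace 'cV[R]_n})
    (w : 'cV[R]_m) :
  reflect (exists2 v, v \in V & w = A *m v) (w \in mximage A V).
Proof.
by apply: (iffP memv_imgP) => -[v vV ->]; exists v; rewrite // ?mxhomE.
Qed.

Lemma mem_mxrangeP (R : realType) m n (A : 'M[R]_(m, n)) (w : 'cV[R]_m) :
  reflect (exists x, w = A *m x) (w \in mxrange A).
Proof.
apply: (iffP (mem_mximageP _ _ _)) => [[v _ ->]|[v ->]]; exists v => //.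
exact: memvf.
Qed.

Lemma mem_mxnull (R : realType) m n (A : 'M[R]_(m, n)) (v : 'cV[R]_n) :
  (v \in mxnull A) = (A *m v == 0).
Proof. by rewrite memv_ker mxhomE. Qed.

Lemma dim_cV (R : realType) n : \dim (fullv : {vspace 'cV[R]_n}) = n.
Proof. by rewrite dimvf dim_matrix mulr1. Qed.

Lemma enorm_orthonormal (R : realType) d s (B : 'M[R]_(d, s)) x :
  B^T *m B = 1%:M -> enorm (B *m x) = enorm x.
Proof. by move=> BB; rewrite /enorm dot_mulmxl mulmxA BB mul1mx. Qed.

Lemma dim_mxrange_orthonormal (R : realType) d s (B : 'M[R]_(d, s)) :
  B^T *m B = 1%:M -> \dim (mxrange B) = s.
Proof.
move=> BB; rewrite -[RHS](dim_cV R); apply: limg_dim_eq.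
apply/eqP; rewrite -subv0; apply/subvP => x /memv_capP[_].
rewrite mem_mxnull memv0 => /eqP Bx.
by rewrite -enorm_eq0 -(enorm_orthonormal x BB) Bx enorm0.
Qed.

(** Gram-Schmidt: a vector of V outside the span of the columns obtained so far
    is made orthogonal to them and normalized. *)
Lemma orthonormal_family_exists (R : realType) d (V : {vspace 'cV[R]_d}) k :
  (k <= \dim V)%N ->
  exists2 B : 'M[R]_(d, k), B^T *m B = 1%:M & (mxrange B <= V)%VS.
Proof.
elim: k => [_|k IH kV].
  exists 0; first by apply/matrixP; case.
  by apply/subvP => _ /mem_mxrangeP[x ->]; rewrite mul0mx mem0v.
have [B BB BV] := IH (ltnW kV).
have /subvPn[v vV vB] : ~~ (V <= mxrange B)%VS.
  by apply: contraL kV => /dimvS; rewrite dim_mxrange_orthonormal // -ltnNge.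
pose w := v - B *m (B^T *m v).
have w0 : w != 0.
  by apply: contra vB; rewrite subr_eq0 => /eqP ->; apply/mem_mxrangeP; eexists.
have Bw : B^T *m w = 0 by rewrite mulmxBr !mulmxA BB mul1mx subrr.
pose u := (enorm w)^-1 *: w.
have Bu : B^T *m u = 0 by rewrite -scalemxAr Bw scaler0.
have uV : u \in V.
  rewrite memvZ // memvB //.
  by apply: (subvP BV); apply/mem_mxrangeP; exists (B^T *m v).
exists (row_mx u B : 'M_(d, k.+1)).
  rewrite -[k.+1]/(1 + k)%N tr_row_mx mul_col_row BB Bu.
  have -> : u^T *m B = 0 by rewrite -[LHS]trmxK trmx_mul trmxK Bu trmx0.
  have -> : u^T *m u = 1%:M.
    by apply/matrixP => i j; rewrite !ord1 -[LHS]/(dot u u) -enorm_sqr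
      enorm_normalize // expr1n mxE.
  by rewrite -scalar_mx_block.
apply/subvP => _ /mem_mxrangeP[x ->].
have -> : row_mx u B *m (x : 'cV_(1 + k)) =
    u *m @usubmx R 1 k 1 x + B *m @dsubmx R 1 k 1 x.
  by rewrite -{1}[x](@vsubmxK _ 1 k) mul_row_col.
apply: memvD.
  by rewrite (mx11_scalar (@usubmx R 1 k 1 x)) mul_mx_scalar; exact: memvZ.
by apply: (subvP BV); apply/mem_mxrangeP; eexists.
Qed.

Lemma orthonormal_basis_exists (R : realType) d s (V : {vspace 'cV[R]_d}) :
  \dim V = s -> exists B : 'M[R]_(d, s), orthonormal_basis V B.
Proof.
move=> dV; have [|B BB BV] := @orthonormal_family_exists R d V s.
  by rewrite dV.
exists B; split=> //; apply/eqP.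
by rewrite eqEdim BV dim_mxrange_orthonormal // dV leqnn.
Qed.

(** * The maximal principal angle *)

(** The least singular value of V_B^T W_B is the minimum over unit vectors w of
    W of the length of the orthogonal projection of w to V. So the maximal
    principal angle is the maximum over w in W of the minimum over v in V of the
    angle between v and w. *)
Lemma max_angle_minmax (R : realType) d s (V W : {vspace 'cV[R]_d}) :
  (0 < s)%N -> \dim V = s -> \dim W = s ->
  exists2 c : R, 0 <= c <= 1 & [/\ max_angle s V W = acos c,
    forall w, w \in W -> enorm w = 1 ->
      exists v, [/\ v \in V, enorm v = 1 & c <= dot v w] &
    exists w, [/\ w \in W, enorm w = 1 &
      forall v, v \in V -> enorm v = 1 -> dot v w <= c]].
Proof.
move=> s0 dV dW; rewrite /max_angle.
case: xgetP => [t _ [VB [WB [sv [bV bW svM tE]]]]|noangle]; last first.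
  have [VB bV] := orthonormal_basis_exists dV.
  have [WB bW] := orthonormal_basis_exists dW.
  have [sv svM] := singular_values_exist (VB^T *m WB).
  by case: (noangle (acos sv`_s.-1)); exists VB, WB, sv.
case: bV bW => [VV rV] [WW rW].
have c0 := singular_values_last_ge0 svM.
have near w : w \in W -> enorm w = 1 ->
    exists v, [/\ v \in V, enorm v = 1 & sv`_s.-1 <= dot v w].
  rewrite -{1}rW => /mem_mxrangeP[x ->]; rewrite enorm_orthonormal // => x1.
  have := singular_value_last_le x svM; rewrite x1 mulr1 -mulmxA.
  set m := VB^T *m _ => le_m.
  (* If w is orthogonal to V, the bound is 0 and any unit y will do. *)
  pose y := if m == 0 then x else (enorm m)^-1 *: m.
  have y1 : enorm y = 1 by rewrite /y; case: ifPn => // /enorm_normalize.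
  exists (VB *m y); split; last 1 first.
  - rewrite dot_mulmxl -/m /y; case: ifPn le_m => [/eqP ->|m0].
      by rewrite enorm0 dot0r.
    by rewrite dotZl -enorm_sqr expr2 mulKf // enorm_eq0.
  - by rewrite -rV; apply/mem_mxrangeP; exists y.
  - by rewrite enorm_orthonormal.
have [x x1 xE] := singular_value_last_attained s0 svM.
have WBx : WB *m x \in W by rewrite -rW; apply/mem_mxrangeP; exists x.
have WBx1 : enorm (WB *m x) = 1 by rewrite enorm_orthonormal.
exists sv`_s.-1.
  rewrite c0 /=; have [v [_ v1 /le_trans]] := near _ WBx WBx1; apply.
  by have /andP[] := dot1_itv v1 WBx1.
split=> //; exists (WB *m x); split=> // v.
rewrite -{1}rV => /mem_mxrangeP[y ->]; rewrite enorm_orthonormal // => y1.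
rewrite dot_mulmxl mulmxA -xE -[leRHS]mul1r -y1; exact: dot_le_enorm.
Qed.

Lemma max_angle_near (R : realType) d s (V W : {vspace 'cV[R]_d}) w :
  (0 < s)%N -> \dim V = s -> \dim W = s -> w \in W -> enorm w = 1 ->
  exists v, [/\ v \in V, enorm v = 1 & acos (dot v w) <= max_angle s V W].
Proof.
move=> s0 dV dW wW w1.
have [c /andP[c0 c1] [-> near _]] := max_angle_minmax s0 dV dW.
have [v [vV v1 cv]] := near w wW w1; exists v; split=> //.
apply: acos_le => //; first by rewrite (le_trans _ c0) // lerN10.
by have /andP[] := dot1_itv v1 w1.
Qed.

Lemma max_angle_far (R : realType) d s (V W : {vspace 'cV[R]_d}) :
  (0 < s)%N -> \dim V = s -> \dim W = s ->
  exists w, [/\ w \in W, enorm w = 1 &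
    forall v, v \in V -> enorm v = 1 -> max_angle s V W <= acos (dot v w)].
Proof.
move=> s0 dV dW.
have [c /andP[c0 c1] [-> _ [w [wW w1 far]]]] := max_angle_minmax s0 dV dW.
exists w; split=> // v vV v1; apply: acos_le => //; last exact: far.
by have /andP[] := dot1_itv v1 w1.
Qed.

Lemma max_angle_triangle (R : realType) d s (U V W : {vspace 'cV[R]_d}) :
  (0 < s)%N -> \dim U = s -> \dim V = s -> \dim W = s ->
  max_angle s U W <= max_angle s U V + max_angle s V W.
Proof.
move=> s0 dU dV dW; have [w [wW w1 far]] := max_angle_far s0 dU dW.
have [v [vV v1 vw]] := max_angle_near s0 dV dW wW w1.
have [u [uU u1 uv]] := max_angle_near s0 dU dV vV v1.
apply: (le_trans (far u uU u1)).
by apply: (le_trans (acos_dot_triangle u1 v1 w1)); exact: lerD.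
Qed.

(** For rho >= 1 the bound exceeds pi / 2. For rho < 1 the vector v close to a
    nonzero w is itself nonzero. *)
Lemma max_angle_le_close (R : realType) d s (V W : {vspace 'cV[R]_d})
    (rho : R) :
  (0 < s)%N -> \dim V = s -> \dim W = s ->
  (forall w, w \in W -> exists2 v, v \in V &
     enorm (v - w) <= rho * Num.max (enorm v) (enorm w)) ->
  max_angle s V W <= 2 * rho.
Proof.
move=> s0 dV dW close; have [rho1|rho1] := ltP rho 1; last first.
  have [c c01 [-> _ _]] := max_angle_minmax s0 dV dW.
  apply: (le_trans (acos_le_pihalf c01)); apply: (le_trans (pihalf_le2 R)).
  by rewrite -[leLHS]mulr1 ler_pM2l.
have [w [wW w1 far]] := max_angle_far s0 dV dW.
have w0 := enorm1_neq0 w1; have [v vV] := close w wW.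
have [->|v0] := eqVneq v 0.
  by rewrite sub0r enormN enorm0 w1 (max_idPr _) ?ler01 // mulr1 leNgt rho1.
move=> vw; have v1 := enorm_normalize v0.
apply: (le_trans (far _ (memvZ _ vV) v1)).
have wE : w = (enorm w)^-1 *: w by rewrite w1 invr1 scale1r.
rewrite [X in dot _ X]wE; move: vw; case: (leP (enorm v) (enorm w)) => _ vw.
  rewrite dotC; apply: (acos_normalize_le w0 v0 rho1 _).2.
  by rewrite enorm_distC.
by apply: (acos_normalize_le v0 w0 rho1 _).2.
Qed.

(** * The minimal principal angle *)

Lemma lfun_enorm_bounded (R : realType) m n (f : 'Hom('cV[R]_m, 'cV[R]_n)) :
  exists2 M, 0 <= M & forall v, enorm (f v) <= M * enorm v.
Proof.
pose A : 'M[R]_(n, m) := \matrix_(i, j) f (delta_mx j 0) i 0.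
have fE v : f v = A *m v.
  rewrite [in LHS](matrix_sum_delta v) linear_sum /=.
  apply/matrixP => i k; rewrite ord1 summxE !mxE; apply: eq_bigr => j _.
  by rewrite big_ord1 linearZ /= !mxE mulrC.
have [M M0 hM] := mulmx_enorm_bounded A.
by exists M => // v; rewrite fE.
Qed.

(** The projection to U along V is bounded on the sum of V and U, which keeps
    unit vectors of V and U apart. *)
Lemma disjoint_dot_gap (R : realType) d (V U : {vspace 'cV[R]_d}) :
  (V :&: U = 0)%VS -> exists2 g, g < 1 &
  forall v u, v \in V -> u \in U -> enorm v = 1 -> enorm u = 1 -> dot v u <= g.
Proof.
move=> VU0; have UV0 : (U :&: V = 0)%VS by rewrite capvC.
have [M M0 hM] := lfun_enorm_bounded (daddv_pi U V).
(* For unit vectors 1 <= M^2 |v - u|^2 = 2 M^2 (1 - v . u); the summand 1 in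
   the denominator makes it positive also when M = 0. *)
pose g := 1 - (M ^+ 2 *+ 2 + 1)^-1.
have M2 : 0 < M ^+ 2 *+ 2 + 1 by rewrite ltr_wpDl // mulrn_wge0 // sqr_ge0.
exists g; first by rewrite /g ltrBlDr ltrDl invr_gt0.
move=> v u vV uU v1 u1.
have piv : daddv_pi U V v = 0.
  have := daddv_pi_add UV0 (subvP (addvSr U V) v vV).
  by rewrite (daddv_pi_id VU0 vV) -[RHS]add0r => /addIr.
have := hM (v - u); rewrite linearB /= piv daddv_pi_id // sub0r enormN u1 => h1.
have : 1 <= M ^+ 2 * dot (v - u) (v - u).
  by rewrite -enorm_sqr -exprMn exprn_ege1.
rewrite !(dotBl, dotBr) (dotC u v) -!enorm_sqr v1 u1 expr1n => h.
rewrite /g lerBrDl -lerBrDr -[leLHS]mul1r ler_pdivrMr //.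
have := dot_le_enorm v u; rewrite v1 u1 mulr1 -[_ *+ 2]mulr_natr; nra.
Qed.

(** The distance of u to V is |u| times the sine of the angle between u and V,
    which is at least the minimal principal angle, and sin t >= t / 2. *)
Lemma min_angle_dist (R : realType) d (V U : {vspace 'cV[R]_d}) :
  V != 0%VS -> U != 0%VS -> (V :&: U = 0)%VS ->
  0 < min_angle V U /\
  forall v u, v \in V -> u \in U ->
    min_angle V U / 2 * enorm u <= enorm (v - u).
Proof.
move=> V0 U0 VU0; rewrite /min_angle; set S := [set c | _]%classic.
have [v0 v0V v01] : exists2 v, v \in V & enorm v = 1.
  exists ((enorm (vpick V))^-1 *: vpick V); first by rewrite memvZ ?memv_pick.
  by rewrite enorm_normalize // vpick0.
have [u0 u0U u01] : exists2 u, u \in U & enorm u = 1.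
  exists ((enorm (vpick U))^-1 *: vpick U); first by rewrite memvZ ?memv_pick.
  by rewrite enorm_normalize // vpick0.
have [g g1 gap] := disjoint_dot_gap VU0.
have Sg : ubound S g by move=> _ [v [u [vV uU v1 u1 ->]]]; exact: gap.
have Sle c : S c -> c <= sup S by apply: ub_le_sup; exists g.
have Sdot : S (dot v0 u0) by exists v0, u0.
have SdotN : S (- dot v0 u0).
  by exists (- v0), u0; rewrite memvN enormN dotNl.
have c0 : 0 <= sup S by have := Sle _ Sdot; have := Sle _ SdotN; lra.
have c1 : sup S < 1.
  by apply: le_lt_trans g1; apply: ge_sup => //; exists (dot v0 u0).
have c01 : 0 <= sup S <= 1 by rewrite c0 ltW.
split; first by rewrite acos_gt0 // c1 andbT (le_trans _ c0) // lerN10.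
move=> v u vV uU; set c := sup S in c0 c1 c01 Sle *.
have s1 : acos c / 2 <= Num.sqrt (1 - c ^+ 2).
  by have := acos_le_sqrt c01; lra.
apply: (le_trans (ler_wpM2r (enorm_ge0 u) s1)).
have vu : dot v u <= c * (enorm v * enorm u).
  have [->|vn0] := eqVneq v 0; first by rewrite dotC dot0r enorm0 mul0r mulr0.
  have [->|un0] := eqVneq u 0; first by rewrite dot0r enorm0 !mulr0.
  rewrite -ler_pdivrMr ?mulr_gt0 ?enorm_gt0 // mulrC invfM -mulrA -dotZr -dotZl.
  by apply: Sle; do 2 eexists; split; last reflexivity;
    rewrite ?memvZ ?enorm_normalize.
rewrite -ler_sqr ?nnegrE ?mulr_ge0 ?sqrtr_ge0 ?enorm_ge0 // exprMn.
rewrite sqr_sqrtr; last by nra.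
rewrite [leRHS]enorm_sqr !(dotBl, dotBr) (dotC u v) -!enorm_sqr.
have := sqr_ge0 (enorm v - c * enorm u); nra.
Qed.

(** * Images of subspaces transversal to the kernel of a projector *)

Lemma mem_mxrange_proj (R : realType) d (P : 'M[R]_d) (x : 'cV[R]_d) :
  P *m P = P -> (x \in mxrange P) = (P *m x == x).
Proof.
move=> PP; apply/mem_mxrangeP/eqP => [[y ->]|<-]; last by exists x.
by rewrite mulmxA PP.
Qed.

Lemma dim_mximage_inj (R : realType) d (A : 'M[R]_d) (V : {vspace 'cV[R]_d}) :
  (forall x, x \in V -> A *m x = 0 -> x = 0) -> \dim (mximage A V) = \dim V.
Proof.
move=> injA; apply: limg_dim_eq; apply/eqP; rewrite -subv0.
apply/subvP => x /memv_capP[xV]; rewrite mem_mxnull memv0 => /eqP Ax.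
by rewrite (injA x).
Qed.

(** A vector v of V splits as x + u along range and kernel of P, with
    |u| <= (2 / theta) |x|. The matrix Phi shrinks x at most by the factor 1 / a
    and stretches u at most by b, so Phi v and Phi x are relatively close. Since
    P maps V onto its range, every vector of the two image subspaces occurs in
    such a pair. *)
Lemma transversal_image_close (R : realType) d s (P Phi : 'M[R]_d)
    (V : {vspace 'cV[R]_d}) (a b : R) :
  P *m P = P -> (0 < s)%N -> \dim V = s -> \dim (mxrange P) = s ->
  mxnull P != 0%VS -> (V :&: mxnull P = 0)%VS -> Phi \in unitmx ->
  0 <= a -> 0 <= b ->
  (forall x, x \in mxrange P -> enorm x <= a * enorm (Phi *m x)) ->
  (forall u, u \in mxnull P -> enorm (Phi *m u) <= b * enorm u) ->
  let rho := a * b * (2 / min_angle V (mxnull P)) in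
  max_angle s (mximage Phi V) (mximage Phi (mxrange P)) <= 2 * rho /\
  max_angle s (mximage Phi (mxrange P)) (mximage Phi V) <= 2 * rho.
Proof.
move=> PP s0 dV dP nP VnP Phiu a0 b0 lower upper rho.
have V0 : V != 0%VS by rewrite -dimv_eq0 dV -lt0n.
have [th0 dist] := min_angle_dist V0 nP VnP.
have close v : v \in V ->
    enorm (Phi *m v - Phi *m (P *m v)) <= rho * enorm (Phi *m (P *m v)).
  move=> vV; rewrite -mulmxBr; set u := v - P *m v.
  have unP : u \in mxnull P by rewrite mem_mxnull mulmxBr mulmxA PP subrr.
  have := dist v u vV unP; rewrite [v - u]subKr => ux.
  have xP : P *m v \in mxrange P by apply/mem_mxrangeP; exists v.
  have := lower _ xP; have := upper u unP.
  set p := enorm (Phi *m u); set q := enorm (Phi *m _) => pu xq.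
  have ux' : enorm u <= 2 / min_angle V (mxnull P) * enorm (P *m v).
    by rewrite mulrAC ler_pdivlMr //; lra.
  apply: (le_trans pu); rewrite /rho [a * b]mulrC -[b * a * _]mulrA.
  rewrite -[leRHS]mulrA ler_wpM2l //.
  apply: (le_trans ux'); rewrite -[leRHS]mulrA [leRHS]mulrCA.
  by rewrite ler_wpM2l // divr_ge0 // ltW.
have PV : mximage P V = mxrange P.
  apply/eqP; rewrite eqEdim; apply/andP; split.
    by apply/subvP => _ /mem_mximageP[x _ ->]; apply/mem_mxrangeP; exists x.
  rewrite dim_mximage_inj ?dV ?dP // => x xV Px; apply/eqP.
  by rewrite -memv0 -VnP memv_cap xV mem_mxnull Px eqxx.
have rho0 : 0 <= rho by rewrite !mulr_ge0 // invr_ge0 ltW.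
have inj x : Phi *m x = 0 -> x = 0.
  by move/(congr1 (mulmx (invmx Phi))); rewrite mulKmx // mulmx0.
have dimPhi W : \dim W = s -> \dim (mximage Phi W) = s.
  by move=> <-; apply: dim_mximage_inj => x _ /inj.
split; apply: max_angle_le_close; rewrite ?dimPhi //.
- move=> _ /mem_mximageP[x + ->]; rewrite -PV => /mem_mximageP[v vV ->].
  exists (Phi *m v); first by apply/mem_mximageP; exists v.
  by apply: (le_trans (close v vV)); rewrite ler_wpM2l // le_max lexx orbT.
- move=> _ /mem_mximageP[v vV ->]; exists (Phi *m (P *m v)).
    by apply/mem_mximageP; exists (P *m v) => //; apply/mem_mxrangeP; exists v.
  rewrite enorm_distC; apply: (le_trans (close v vV)).
  by rewrite ler_wpM2l // le_max lexx.
Qed.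

(** * The solution operator and the fibers *)

HB.instance Definition _ (R : realType) d :=
  Monoid.isLaw.Build 'M[R]_d 1%:M (@mulmx R d d d)
    (@mulmxA R d d d d) (@mul1mx R d d) (@mulmx1 R d d).

Lemma prod_rev_invmx (R : realType) d (A : nat -> 'M[R]_d) l :
  (forall n, A n \in unitmx) ->
  \big[mulmx/1%:M]_(k <- rev l) A k *m \big[mulmx/1%:M]_(k <- l) invmx (A k) =
  1%:M.
Proof.
move=> Au; elim: l => [|k l IH]; first by rewrite !big_nil mulmx1.
by rewrite rev_cons -cats1 big_cat big_seq1 big_cons mulmxA /= mulmxK.
Qed.

Lemma solopK (R : realType) d (A : nat -> 'M[R]_d) m n :
  (forall n, A n \in unitmx) -> (m <= n)%N ->
  solop A n m *m solop A m n = 1%:M.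
Proof.
move=> Au mn; rewrite {1}/solop mn /solop; case: leqP => nm; last first.
  exact: prod_rev_invmx.
have -> : m = n by apply/eqP; rewrite eqn_leq mn.
by rewrite /index_iota subnn !big_nil mulmx1.
Qed.

Section Fibers.
Variables (R : realType) (d : nat) (A : nat -> 'M[R]_d) (kappa : nat).
Variables (sm sp : nat -> R) (K : nat -> R -> R) (P : nat -> nat -> 'M[R]_d).
Hypothesis dichP : dichotomy A kappa sm sp K P.

Lemma mxrange_fiber n i : (1 <= i <= kappa)%N ->
  mxrange (P n i) = (fiber P n i + mxrange (P n i.+1))%VS.
Proof.
move=> ik; have /andP[i1 ik1] := ik.
have PP : P n i *m P n i = P n i.
  by apply: (dich_proj dichP); rewrite i1 leqW.
have QQ : P n i.+1 *m P n i.+1 = P n i.+1 by exact: (dich_proj dichP).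
have mono := dich_range_mono dichP n ik.
apply/eqP; rewrite eqEsubv; apply/andP; split; last first.
  by rewrite subv_add mono /fiber capvSl.
apply/subvP => x xP; rewrite -[x](subrK (P n i.+1 *m x)).
have Qx : P n i.+1 *m x \in mxrange (P n i.+1).
  by apply/mem_mxrangeP; exists x.
apply: memv_add => //; rewrite memv_cap; apply/andP; split.
  by rewrite memvB // (subvP mono).
by rewrite mem_mxnull mulmxBr mulmxA QQ subrr.
Qed.

Lemma fiber_cap_mxrange n i : (1 <= i <= kappa)%N ->
  (fiber P n i :&: mxrange (P n i.+1) = 0)%VS.
Proof.
move=> ik; have QQ : P n i.+1 *m P n i.+1 = P n i.+1.
  by apply: (dich_proj dichP); case/andP: ik.
apply/eqP; rewrite -subv0; apply/subvP => x; rewrite !memv_cap -andbA.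
case/and3P => _; rewrite mem_mxnull mem_mxrange_proj // => /eqP -> /eqP <-.
exact: mem0v.
Qed.

Lemma fiber_sum_mxrange n j : (1 <= j <= kappa.+1)%N ->
  fiber_sum P n j kappa.+1 = mxrange (P n j).
Proof.
case/andP => j1 /subnK; move: (kappa.+1 - j)%N => k.
elim: k j j1 => [|k IH] j j1 jk.
  have -> : j = kappa.+1 by exact: jk.
  by rewrite /fiber_sum big_geq // (dich_range_last dichP).
have jK : (j <= kappa)%N by rewrite -ltnS -jk addSn ltnS leq_addl.
have jk' : (k + j.+1)%N = kappa.+1 by rewrite addnS -addSn.
by rewrite mxrange_fiber ?j1 // -IH // /fiber_sum big_ltn.
Qed.

Lemma dim_mxrange_fiber n j : (1 <= j <= kappa.+1)%N ->
  \dim (mxrange (P n j)) = (\sum_(j <= i < kappa.+1) \dim (fiber P n i))%N.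
Proof.
case/andP => j1 /subnK; move: (kappa.+1 - j)%N => k.
elim: k j j1 => [|k IH] j j1 jk.
  have -> : j = kappa.+1 by exact: jk.
  by rewrite big_geq // (dich_range_last dichP) dimv0.
have jK : (j <= kappa)%N by rewrite -ltnS -jk addSn ltnS leq_addl.
rewrite mxrange_fiber ?j1 // dimv_disjoint_sum ?fiber_cap_mxrange ?j1 //.
have jk' : (k + j.+1)%N = kappa.+1 by rewrite addnS -addSn.
by rewrite (IH j.+1) // [RHS]big_ltn.
Qed.

Lemma fiber_sum_mxnull n j : (1 <= j <= kappa.+1)%N ->
  fiber_sum P n 1 j = mxnull (P n j).
Proof.
elim: j => [//|[|j] IH] jk.
  by rewrite /fiber_sum big_geq // (dich_null_first dichP).
have jk' : (1 <= j.+1 <= kappa)%N by case/andP: jk.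
have -> : fiber_sum P n 1 j.+2 = (fiber_sum P n 1 j.+1 + fiber P n j.+1)%VS.
  by rewrite /fiber_sum big_nat_recr.
rewrite IH; last by case/andP: jk => _ /ltnW.
have PP : P n j.+1 *m P n j.+1 = P n j.+1.
  by apply: (dich_proj dichP); case/andP: jk => _ /ltnW.
have mono := dich_null_mono dichP n jk'.
apply/eqP; rewrite eqEsubv subv_add mono capvSr /=.
apply/subvP => x xQ; rewrite -[x](subrK (P n j.+1 *m x)).
have xP : x - P n j.+1 *m x \in mxnull (P n j.+1).
  by rewrite mem_mxnull mulmxBr mulmxA PP subrr.
apply: memv_add => //; rewrite memv_cap; apply/andP; split.
  by apply/mem_mxrangeP; exists x.
by rewrite -[_ *m x](subKr x) memvB // (subvP mono).
Qed.

Hypothesis Au : forall n, A n \in unitmx.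

Lemma solop_unit m n : (m <= n)%N -> solop A m n \in unitmx.
Proof. by move=> mn; have [] := mulmx1_unit (solopK Au mn). Qed.

Lemma solop_mxrange m n j : (m <= n)%N -> (1 <= j <= kappa.+1)%N ->
  mximage (solop A m n) (mxrange (P n j)) = mxrange (P m j).
Proof.
move=> mn jk; have inv := dich_invariant dichP mn jk.
have FB := solopK Au mn; have BF := mulmx1C FB.
have comm : solop A m n *m P n j = P m j *m solop A m n.
  by rewrite -[LHS]mulmx1 -FB mulmxA -[X in X *m _]mulmxA -inv mulmxA BF mul1mx.
apply/vspaceP => w; apply/mem_mximageP/mem_mxrangeP => [[x]|[x ->]].
  case/mem_mxrangeP => y -> ->; exists (solop A m n *m y).
  by rewrite !mulmxA comm.
exists (P n j *m (solop A n m *m x)).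
  by apply/mem_mxrangeP; eexists.
by rewrite mulmxA comm -mulmxA [solop A m n *m _]mulmxA BF mul1mx.
Qed.

Lemma dim_mximage_solop m n (V : {vspace 'cV[R]_d}) : (m <= n)%N ->
  \dim (mximage (solop A m n) V) = \dim V.
Proof.
move=> mn; apply: dim_mximage_inj => x _.
move/(congr1 (mulmx (invmx (solop A m n)))).
by rewrite mulKmx ?solop_unit // mulmx0.
Qed.

Lemma dim_mxrange_dichotomy n j : (1 <= j <= kappa.+1)%N ->
  \dim (mxrange (P n j)) = \dim (mxrange (P 0 j)).
Proof.
by move=> jk; rewrite -(solop_mxrange (leq0n n) jk) dim_mximage_solop.
Qed.

(** Up to the factor K i e, a backward evolution over n steps shrinks vectors of
    the range of the projector at most by (sp i.+1 + e)^-n and expands those of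
    its kernel at most by (sm i - e)^-n. The factor enters once for each of the
    two estimates. *)
Lemma dichotomy_convergence N n i e s (V : {vspace 'cV[R]_d}) :
  (n <= N)%N -> (1 <= i < kappa)%N -> 0 < e -> e < sm i - sp i.+1 ->
  0 < sp i.+1 + e -> 0 < sm i - e ->
  (0 < s < d)%N -> \dim V = s -> \dim (mxrange (P N i.+1)) = s ->
  (V :&: mxnull (P N i.+1) = 0)%VS ->
  let X := mxrange (P N i.+1) in
  let theta := min_angle V (mxnull (P N i.+1)) in
  let B := 4 * K i e ^+ 2 / theta * ((sp i.+1 + e) / (sm i - e)) ^+ n in
  [/\ 0 < theta,
      max_angle s (mximage (solop A (N - n) N) V)
                  (mximage (solop A (N - n) N) X) <= B &
      max_angle s (mximage (solop A (N - n) N) X)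
                  (mximage (solop A (N - n) N) V) <= B].
Proof.
move=> nN /andP[i1 ik] e0 egap al0 be0 /andP[s0 sd] dV dX VX X theta B.
have ik' : (1 <= i <= kappa)%N by rewrite i1 ltnW.
have ik2 : (1 <= i.+1 <= kappa.+1)%N by rewrite /= ltnS ltnW.
have mN := leq_subr n N; set m := (N - n)%N in mN B *.
have Nm : (N - m)%N = n by rewrite /m subKn.
have := dich_forward dichP ik' e0 egap mN.
have := dich_backward dichP ik' e0 egap mN; rewrite Nm => back forw.
have PP : P N i.+1 *m P N i.+1 = P N i.+1 by exact: (dich_proj dichP).
have nP : mxnull (P N i.+1) != 0%VS.
  rewrite -dimv_eq0 -lt0n.
  have := limg_ker_dim (mxhom (P N i.+1)) fullv; rewrite capfv dim_cV.
  by rewrite -/(mxnull _) -/(mxrange _) dX => dE; rewrite -(ltn_add2r s) dE.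
have K0 : 0 <= K i e.
  have := le_trans (opnorm_ge0 _) back.
  by rewrite pmulr_lge0 // invr_gt0 exprn_gt0.
have V0 : V != 0%VS by rewrite -dimv_eq0 dV -lt0n.
have [th0 _] := min_angle_dist V0 nP VX.
have lower x : x \in mxrange (P N i.+1) ->
    enorm x <= K i e * (sp i.+1 + e) ^+ n * enorm (solop A m N *m x).
  move=> xX; apply: le_trans (ler_wpM2r (enorm_ge0 _) forw).
  have : solop A m N *m x \in mxrange (P m i.+1).
    by rewrite -(solop_mxrange mN ik2); apply/mem_mximageP; exists x.
  rewrite mem_mxrange_proj ?(dich_proj dichP) // => /eqP Px.
  apply: le_trans (enorm_mulmx_le _ _).
  by rewrite -mulmxA Px mulmxA solopK // mul1mx.
have upper u : u \in mxnull (P N i.+1) ->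
    enorm (solop A m N *m u) <= K i e * (sm i - e) ^- n * enorm u.
  rewrite mem_mxnull => /eqP Pu; apply: le_trans (ler_wpM2r (enorm_ge0 _) back).
  apply: le_trans (enorm_mulmx_le _ _).
  by rewrite -mulmxA mulmxBl mul1mx Pu subr0.
have a0 : 0 <= K i e * (sp i.+1 + e) ^+ n.
  by rewrite mulr_ge0 // exprn_ge0 // ltW.
have b0 : 0 <= K i e * (sm i - e) ^- n.
  by rewrite mulr_ge0 // invr_ge0 exprn_ge0 // ltW.
have := transversal_image_close PP s0 dV dX nP VX (solop_unit mN) a0 b0
  lower upper.
rewrite /= -/theta => -[].
have -> : 2 * (K i e * (sp i.+1 + e) ^+ n * (K i e * (sm i - e) ^- n) *
    (2 / theta)) = B by rewrite /B expr_div_n; ring.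
by [].
Qed.

End Fibers.
(** * Constants uniform in the spectral gap *)

(** Shrinking each gap by a third on either side leaves two positive rates with
    quotient below 1: the numbers sp i are nonnegative, since they decrease in i
    down to sp kappa.+1 = 0. A maximum over the finitely many gaps is then
    uniform. *)
Lemma spectral_gap_constants (R : realType) kappa (sm sp : nat -> R)
    (K : nat -> R -> R) : spectral_data kappa sm sp ->
  exists e : nat -> R, exists r L : R, [/\ 0 < r, r < 1, 0 < L &
    forall i, (1 <= i <= kappa)%N ->
    [/\ 0 < e i /\ e i < sm i - sp i.+1, 0 < sp i.+1 + e i, 0 < sm i - e i,
        (sp i.+1 + e i) / (sm i - e i) <= r & 4 * K i (e i) ^+ 2 <= L]].
Proof.
case=> sp0 gap; pose e i := (sm i - sp i.+1) / 3.
have sp_ge0 i : (1 <= i <= kappa.+1)%N -> 0 <= sp i.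
  case/andP => i1 /subnK; move: (kappa.+1 - i)%N => k.
  elim: k i i1 => [|k IH] i i1 ik.
    have -> : i = kappa.+1 by exact: ik.
    by rewrite sp0.
  have [|gap1 gap2] := gap i; first by rewrite i1 -ltnS -ik addSn ltnS leq_addl.
  have := IH i.+1 isT; rewrite addnS -addSn ik => /(_ erefl).
  by move=> h; apply: ltW; apply: le_lt_trans h _; apply: lt_le_trans gap1 _.
exists e; pose q i := (sp i.+1 + e i) / (sm i - e i).
have step i : (1 <= i <= kappa)%N -> [/\ 0 < e i /\ e i < sm i - sp i.+1,
    0 < sp i.+1 + e i, 0 < sm i - e i & q i < 1].
  move=> ik; have [gap1 gap2] := gap i ik.
  have spi : 0 <= sp i.+1 by apply: sp_ge0; case/andP: ik.
  have e0 : 0 < e i by rewrite /e divr_gt0 // subr_gt0.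
  have eE : e i * 3 = sm i - sp i.+1 by rewrite /e mulfVK // pnatr_eq0.
  have be0 : 0 < sm i - e i by lra.
  by split; [split=> //; lra|lra|lra|rewrite /q ltr_pdivrMr //; lra].
exists (\big[Num.max/2^-1]_(1 <= i < kappa.+1) q i).
exists (\big[Num.max/1]_(1 <= i < kappa.+1) (4 * K i (e i) ^+ 2)); split.
- by apply: (@lt_le_trans _ _ 2^-1); rewrite ?invr_gt0 // bigmax_ge_id.
- rewrite big_nat; elim/big_ind: _ => [|x y x1 y1|i ik].
  + by rewrite invf_lt1 ?ltr1n.
  + by rewrite gt_max x1 y1.
  + by have [] := step i ik.
- by apply: (@lt_le_trans _ _ 1); rewrite // bigmax_ge_id.
move=> i ik; have [e0 al0 be0 _] := step i ik.
have ii : i \in index_iota 1 kappa.+1 by rewrite mem_index_iota.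
split=> //; first exact: (@le_bigmax_seq _ _ _ _ _ i _ q).
exact: (@le_bigmax_seq _ _ _ _ _ i _ (fun i => 4 * K i (e i) ^+ 2)).
Qed.

Lemma sum_geometric_le (R : realType) (r : R) n :
  0 < r -> r < 1 -> \sum_(1 <= k < n.+1) r ^+ k.-1 <= (1 - r)^-1.
Proof.
move=> r0 r1; rewrite big_add1 /= big_mkord -[leRHS]mul1r ler_pdivlMr; last lra.
have := subrX1 r n; have := exprn_ge0 n (ltW r0); set S := \sum_(i < n) _; lra.
Qed.

(** Closeness of the images of V and X at each time gives, by the triangle
    inequality for the maximal principal angle, closeness of the angles between
    successive images; averaging geometrically decaying errors yields the rate 1 / n. *)
Lemma alpha_disc_dist_le (R : realType) d s (A : nat -> 'M[R]_d) N n
    (V X : {vspace 'cV[R]_d}) (c r : R) :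
  (forall m, A m \in unitmx) -> (0 < s)%N -> \dim V = s -> \dim X = s ->
  (1 <= n <= N)%N -> 0 < r -> r < 1 -> 0 <= c ->
  (forall k, (k <= N)%N -> let VX := mximage (solop A (N - k) N) in
     max_angle s (VX V) (VX X) <= c * r ^+ k /\
     max_angle s (VX X) (VX V) <= c * r ^+ k) ->
  `|alpha_disc A s N n V - alpha_disc A s N n X| <= n%:R^-1 * (2 * c / (1 - r)).
Proof.
move=> Au s0 dV dX /andP[n1 nN] r0 r1 c0 close.
rewrite /alpha_disc -mulrBr -sumrB normrM ger0_norm ?invr_ge0 //.
rewrite ler_wpM2l ?invr_ge0 //; apply: (le_trans (ler_norm_sum _ _ _)).
have dimV k : \dim (mximage (solop A (N - k) N) V) = s.
  by rewrite (dim_mximage_solop Au) ?leq_subr.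
have dimX k : \dim (mximage (solop A (N - k) N) X) = s.
  by rewrite (dim_mximage_solop Au) ?leq_subr.
apply: (@le_trans _ _ (\sum_(1 <= k < n.+1) 2 * c * r ^+ k.-1)); last first.
  by rewrite -mulr_sumr ler_wpM2l ?sum_geometric_le // mulr_ge0.
rewrite !big_nat; apply: ler_sum => k /andP[k1 kn].
have kN : (k <= N)%N by rewrite (leq_trans _ nN).
have -> : (N - k + 1 = N - k.-1)%N.
  by rewrite -{1}(prednK k1) addn1 subnSK // prednK.
have [VX1 XV1] := close k.-1 (leq_trans (leq_pred k) kN).
have [VX2 XV2] := close k kN.
have rk : c * r ^+ k <= c * r ^+ k.-1.
  by rewrite ler_wpM2l // -{1}(prednK k1) exprS ler_piMl ?exprn_ge0 // ltW.
move: (dimV k) (dimX k) (dimV k.-1) (dimX k.-1) VX1 XV1 VX2 XV2.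
set V2 := mximage (solop A (N - k) N) V.
set X2 := mximage (solop A (N - k) N) X.
set V1 := mximage _ V; set X1 := mximage _ X.
move=> dV2 dX2 dV1 dX1 VX1 XV1 VX2 XV2.
have := max_angle_triangle s0 dV1 dX1 dV2.
have := max_angle_triangle s0 dX1 dX2 dV2.
have := max_angle_triangle s0 dX1 dV1 dX2.
have := max_angle_triangle s0 dV1 dV2 dX2.
by rewrite ler_norml; move=> *; apply/andP; split; lra.
Qed.

Theorem proposition3p5 (R : realType) (kappa : nat) (sm sp : nat -> R)
    (K : nat -> R -> R) (Hspec : spectral_data kappa sm sp) :
  exists r C : R, [/\ 0 < r, r < 1, 0 < C &
  forall (d s : nat) (A : nat -> 'M[R]_d) (P : nat -> nat -> 'M[R]_d),
    (0 < s < d)%N -> (kappa <= d)%N ->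
    bounded_system A -> dichotomy A kappa sm sp K P ->
  forall (N j : nat) (V : {vspace 'cV[R]_d}),
    (0 < N)%N -> (1 <= j <= kappa)%N -> \dim V = s ->
    s = (\sum_(j <= i < kappa.+1) \dim (fiber P 0 i))%N ->
    (V :&: fiber_sum P N 1 j = 0)%VS ->
  (forall n, (n <= N)%N ->
     max_angle s (mximage (solop A (N - n) N) V)
                 (fiber_sum P (N - n) j kappa.+1)
     <= C / min_angle V (fiber_sum P N 1 j) * r ^+ n) /\
  (forall n, (1 <= n <= N)%N ->
     `|alpha_disc A s N n V
       - alpha_disc A s N n (fiber_sum P N j kappa.+1)|
     <= C / (n%:R * min_angle V (fiber_sum P N 1 j)))].
Proof.
have [e [r [L [r0 r1 L0 consts]]]] := spectral_gap_constants K Hspec.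
have r1' : 0 < 1 - r by rewrite subr_gt0.
exists r, (2 * L / (1 - r)); split=> //; first by rewrite divr_gt0 ?mulr_gt0.
move=> d s A P sd _ [Au _ _] dichP N j V _ jk dV sE.
have jk' : (1 <= j <= kappa.+1)%N by case/andP: jk => -> /leqW.
rewrite (fiber_sum_mxnull dichP) // (fiber_sum_mxrange dichP) // => VX.
have dX m : \dim (mxrange (P m j)) = s.
  by rewrite (dim_mxrange_dichotomy dichP) // sE (dim_mxrange_fiber dichP).
case: j => [|[|i]] in jk jk' sE VX dX *; first by [].
  (* For j = 1 the range is the whole space, which contradicts s < d. *)
  have ds := dX 0%N; rewrite (dich_range_first dichP) dim_cV in ds.
  by case/andP: sd => _; rewrite {1}ds ltnn.
have ik : (1 <= i.+1 <= kappa)%N by case/andP: jk => _ /ltnW.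
have [[e0 egap] al0 be0 qr KL] := consts i.+1 ik.
set theta := min_angle _ _; set X := mxrange (P N i.+2).
have close n : (n <= N)%N -> [/\ 0 < theta,
    max_angle s (mximage (solop A (N - n) N) V) (mximage (solop A (N - n) N) X)
      <= L / theta * r ^+ n &
    max_angle s (mximage (solop A (N - n) N) X) (mximage (solop A (N - n) N) V)
      <= L / theta * r ^+ n].
  move=> nN.
  have [th0 VXn XVn] :=
    dichotomy_convergence (i := i.+1) dichP Au nN jk e0 egap al0 be0 sd dV
      (dX N) VX.
  rewrite -/theta in th0 VXn XVn.
  have bound : 4 * K i.+1 (e i.+1) ^+ 2 / theta *
      ((sp i.+2 + e i.+1) / (sm i.+1 - e i.+1)) ^+ n <= L / theta * r ^+ n.
    apply: ler_pM.
    - by apply: divr_ge0 (ltW th0); rewrite mulr_ge0 // sqr_ge0.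
    - by apply: exprn_ge0; exact: divr_ge0 (ltW al0) (ltW be0).
    - by rewrite ler_wpM2r // invr_ge0 ltW.
    - apply: lerXn2r qr; rewrite nnegrE; last exact: ltW.
      exact: divr_ge0 (ltW al0) (ltW be0).
  by split=> //; [apply: le_trans VXn bound|apply: le_trans XVn bound].
have [th0 _ _] := close 0%N (leq0n N).
have s0 : (0 < s)%N by case/andP: sd.
split=> n nN.
  rewrite (fiber_sum_mxrange dichP) //.
  rewrite -(solop_mxrange dichP Au (leq_subr n N)) //.
  have [_ VXn _] := close n nN; apply: (le_trans VXn).
  apply: ler_wpM2r; first by apply: exprn_ge0; exact: ltW.
  apply: ler_wpM2r; first by rewrite invr_ge0 ltW.
  by rewrite ler_pdivlMr //; nra.
have -> : 2 * L / (1 - r) / (n%:R * theta) =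
    n%:R^-1 * (2 * (L / theta) / (1 - r)).
  by rewrite invfM; ring.
apply: (alpha_disc_dist_le Au s0 dV (dX N) nN r0 r1).
  by rewrite divr_ge0 // ltW.
by move=> k kN; have [_ VXk XVk] := close k kN.
Qed.
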